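(* Let $\mathcal{X}$ be an infinite dimensional complex Banach space and $X\in B(\mathcal{X})$. Let $\mathbb{A}=(A_1,\dots,A_d)$ and $\mathbb{B}=(B_1,\dots,B_d)$ be commuting $d$-tuples in $B(\mathcal{X})^d$ such that $\triangle^{m_1}_{\mathbb{A},\mathbb{B}}\big(\delta^{m_2}_{\mathbb{A},\mathbb{B}}(X)\big)=0$ for some positive integers $m_1$ and $m_2$. Let $\mathbb{N}_i=(N_{i1},\dots,N_{id})\in B(\mathcal{X})^d$, $i=1,2$, be two commuting $n_i$-nilpotent $d$-tuples such that $$[\mathbb{A},\mathbb{N}_1]=[\mathbb{B},\mathbb{N}_2]=0.$$ Then $$\triangle^{t_1}_{\mathbb{A}+\mathbb{N}_1,\mathbb{B}+\mathbb{N}_2}\big(\delta^{t_2}_{\mathbb{A}+\mathbb{N}_1,\mathbb{B}+\mathbb{N}_2}(X)\big)=0,\qquad t_i=m_i+n_1+n_2-2,\ i=1,2.$$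
   Context: $B(\mathcal{X})$ is the algebra of bounded linear operators on $\mathcal{X}$; $d\ge1$ is an integer. A $d$-tuple $(A_1,\dots,A_d)$ is commuting if $A_iA_j=A_jA_i$ for all $i,j$. For $d$-tuples $\mathbb{A},\mathbb{N}$, $[\mathbb{A},\mathbb{N}]=0$ means $A_iN_j=N_jA_i$ for all $1\le i,j\le d$, and $\mathbb{A}+\mathbb{N}=(A_1+N_1,\dots,A_d+N_d)$. For commuting $d$-tuples $\mathbb{A},\mathbb{B}$ define linear operators on $B(\mathcal{X})$ by $$\triangle_{\mathbb{A},\mathbb{B}}(X)=X-\sum_{i=1}^d A_iXB_i,\qquad \delta_{\mathbb{A},\mathbb{B}}(X)=\Big(\sum_{i=1}^d A_i\Big)X-X\Big(\sum_{i=1}^d B_i\Big),$$ with powers meaning iterates. A commuting $d$-tuple $\mathbb{N}=(N_1,\dots,N_d)$ is $n$-nilpotent ($n$ a positive integer) if $\mathbb{N}^{\alpha}=\prod_{i=1}^d N_i^{\alpha_i}=0$ for all $d$-tuples $\alpha=(\alpha_1,\dots,\alpha_d)$ of non-negative integers with $|\alpha|=\sum_i\alpha_i=n$, and $\mathbb{N}^\alpha\ne0$ for at least one $\alpha$ with $|\alpha|\le n-1$. *)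

(* Defs.v *)
From HB Require Import structures.
From mathcomp Require Import all_boot all_order all_algebra.
From mathcomp Require Import boolp classical_sets functions reals.
From mathcomp Require Import topology normedtype.
From mathcomp Require Export complex.

Set Implicit Arguments.
Unset Strict Implicit.
Unset Printing Implicit Defensive.

Import Order.TTheory GRing.Theory Num.Theory.

Local Open Scope ring_scope.

Definition finite_dimensional (K : pzRingType) (V : lmodType K) : Prop :=
  exists (n : nat) (e : 'I_n -> V),
    forall v : V, exists c : 'I_n -> K, v = \sum_(i < n) c i *: e i.

Section BoundedOperators.
Context (K : numFieldType) (V : normedModType K).

Definition bounded_linear : {pred (V -> V)} :=
  fun f => `[< linear f /\ exists M : K, forall x, `|f x| <= M * `|x| >].

Lemma bounded_linearP (f : V -> V) :
  reflect (linear f /\ exists M : K, forall x, `|f x| <= M * `|x|)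
          (f \in bounded_linear).
Proof. exact: asboolP. Qed.

Fact bounded_linear_zmod_closed : zmod_closed bounded_linear.
Proof.
split.
  apply/bounded_linearP; split; first by move=> a x y; rewrite /= scaler0 addr0.
  by exists 0 => x; rewrite /= normr0 mul0r.
move=> f g /bounded_linearP[lf [M fM]] /bounded_linearP[lg [N gN]].
apply/bounded_linearP; split.
  by move=> a x y; rewrite /GRing.add/= /GRing.opp/= lf lg opprD addrACA scalerBr.
exists (M + N) => x; rewrite mulrDl.
by rewrite (le_trans (ler_normB _ _))// lerD.
Qed.

HB.instance Definition _ :=
  GRing.isZmodClosed.Build _ bounded_linear bounded_linear_zmod_closed.

Fact bounded_linear_id : idfun \in bounded_linear.
Proof. by apply/bounded_linearP; split=> //; exists 1 => x; rewrite mul1r. Qed.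

Fact bounded_linear_comp (f g : V -> V) :
  f \in bounded_linear -> g \in bounded_linear -> f \o g \in bounded_linear.
Proof.
move=> /bounded_linearP[lf [M fM]] /bounded_linearP[lg [N gN]].
apply/bounded_linearP; split; first by move=> a x y; rewrite /= lg lf.
exists (`|M| * N) => x /=; apply: (le_trans (fM _)).
have [->|gx0] := eqVneq (g x) 0.
  by rewrite normr0 mulr0 -mulrA mulr_ge0// (le_trans _ (gN x)).
have M0 : 0 <= M.
  by rewrite -(pmulr_lge0 _ (_ : 0 < `|g x|)) ?normr_gt0// (le_trans _ (fM _)).
by rewrite ger0_norm// -mulrA ler_wpM2l.
Qed.

Record bounded_op := BoundedOp
  { bounded_op_fun :> V -> V; _ : bounded_op_fun \in bounded_linear }.

HB.instance Definition _ := [isSub for bounded_op_fun].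
HB.instance Definition _ := [Choice of bounded_op by <:].
HB.instance Definition _ := [SubChoice_isSubZmodule of bounded_op by <:].

Implicit Types f g h : bounded_op.

Definition bounded_op_one := BoundedOp bounded_linear_id.
Definition bounded_op_mul f g := BoundedOp (bounded_linear_comp (valP f) (valP g)).

Fact bounded_op_mulA : associative bounded_op_mul.
Proof. by move=> f g h; apply: val_inj. Qed.
Fact bounded_op_mul1r : left_id bounded_op_one bounded_op_mul.
Proof. by move=> f; apply: val_inj. Qed.
Fact bounded_op_mulr1 : right_id bounded_op_one bounded_op_mul.
Proof. by move=> f; apply: val_inj. Qed.
Fact bounded_op_mulDl : left_distributive bounded_op_mul +%R.
Proof. by move=> f g h; apply: val_inj. Qed.
Fact bounded_op_mulDr : right_distributive bounded_op_mul +%R.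
Proof.
move=> f g h; apply: val_inj; apply/funext => x /=.
have /bounded_linearP[lf _] := valP f.
by have := lf 1 (g x) (h x); rewrite !scale1r.
Qed.

HB.instance Definition _ := GRing.Zmodule_isPzRing.Build bounded_op
  bounded_op_mulA bounded_op_mul1r bounded_op_mulr1
  bounded_op_mulDl bounded_op_mulDr.

End BoundedOperators.

Notation "''B' ( V )" := (bounded_op V) (at level 8, format "''B' ( V )") : type_scope.

Section Tuples.
Context (S : pzRingType) (d : nat).
Implicit Types (A B N : 'I_d -> S) (X : S).

Definition commuting A : Prop := forall i j, A i * A j = A j * A i.

Definition cross_commuting A N : Prop := forall i j, A i * N j = N j * A i.

Definition tuple_add A N : 'I_d -> S := fun i => A i + N i.

Definition Triangle A B X : S := X - \sum_(i < d) A i * X * B i.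

Definition delta A B X : S := (\sum_(i < d) A i) * X - X * (\sum_(i < d) B i).

(* The product is taken in increasing order of the index; this is immaterial
   for a commuting tuple. *)
Definition multi_pow N (alpha : 'I_d -> nat) : S := \prod_(i < d) N i ^+ alpha i.

Definition nilpotent_tuple (n : nat) N : Prop :=
  [/\ (0 < n)%N,
      forall alpha : 'I_d -> nat, (\sum_(i < d) alpha i = n)%N ->
        multi_pow N alpha = 0
    & exists alpha : 'I_d -> nat,
        (\sum_(i < d) alpha i <= n - 1)%N /\ multi_pow N alpha <> 0].

End Tuples.

(* Main.v *)
(** Left and right multiplications by the entries of all four tuples generate
    a commutative ring of additive maps on the operators.  In that ring the
    perturbed [Triangle] and [delta] differ from the original ones by an
    element [u + v] with [u] in the ideal generated by the left
    multiplications by [N1] and [v] in the ideal generated by the right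
    multiplications by [N2], so [u ^+ n1 = 0] and [v ^+ n2 = 0], whence
    [(u + v) ^+ (n1 + n2 - 1) = 0].  By the binomial formula the power
    [m + n1 + n2 - 2] of the perturbed map is a multiple of the [m]-th power of
    the original one. *)
Require Import Defs.
From HB Require Import structures.
From mathcomp Require Import all_boot all_order all_algebra.
From mathcomp Require Import boolp classical_sets functions reals.
From mathcomp Require Import topology normedtype.
From mathcomp Require Import zify.

Import GRing.Theory.
Local Open Scope ring_scope.

(** * The ring of additive endomorphisms of an abelian group *)

Section AdditiveEndomorphisms.
Context {V : zmodType}.

(** Preserving differences is additivity in a single condition: [endo0] and [endoD] recover zero and
    sums from it. *)
Definition additive_map : {pred (V -> V)} :=
  fun f => `[< {morph f : x y / x - y} >].

Lemma additive_mapP (f : V -> V) :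
  reflect {morph f : x y / x - y} (f \in additive_map).
Proof. exact: asboolP. Qed.

Fact additive_map_zmod_closed : zmod_closed additive_map.
Proof.
split; first by apply/additive_mapP => x y; rewrite /= subr0.
move=> f g /additive_mapP fB /additive_mapP gB; apply/additive_mapP => x y.
change (f (x - y) - g (x - y) = f x - g x - (f y - g y)).
by rewrite fB gB !opprB addrACA [RHS]addrACA (addrC (- f y)).
Qed.

HB.instance Definition _ :=
  GRing.isZmodClosed.Build _ additive_map additive_map_zmod_closed.

Fact additive_map_id : idfun \in additive_map.
Proof. exact/additive_mapP. Qed.

Fact additive_map_comp (f g : V -> V) :
  f \in additive_map -> g \in additive_map -> f \o g \in additive_map.
Proof.
by move=> /additive_mapP fB /additive_mapP gB; apply/additive_mapP => x y /=; rewrite gB fB.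
Qed.

(** Bundled so as to carry a ring structure with composition as product; iterates then become
    powers. *)
Record endo := Endo { endo_fun :> V -> V; _ : endo_fun \in additive_map }.

HB.instance Definition _ := [isSub for endo_fun].
HB.instance Definition _ := [Choice of endo by <:].
HB.instance Definition _ := [SubChoice_isSubZmodule of endo by <:].

Implicit Types f g h : endo.

Definition endo_one := Endo _ additive_map_id.
Definition endo_mul f g := Endo _ (additive_map_comp _ _ (valP f) (valP g)).

Lemma endoB f : {morph f : x y / x - y}.
Proof. exact/additive_mapP/(valP f). Qed.

Lemma endo0 f : f 0 = 0.
Proof. by have := endoB f 0 0; rewrite !subrr. Qed.

Lemma endoD f : {morph f : x y / x + y}.
Proof.
by move=> x y; have := endoB f (x + y) y; rewrite addrK => ->; rewrite subrK.
Qed.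

Fact endo_mulA : associative endo_mul.
Proof. by move=> f g h; apply: val_inj. Qed.
Fact endo_mul1r : left_id endo_one endo_mul.
Proof. by move=> f; apply: val_inj. Qed.
Fact endo_mulr1 : right_id endo_one endo_mul.
Proof. by move=> f; apply: val_inj. Qed.
Fact endo_mulDl : left_distributive endo_mul +%R.
Proof. by move=> f g h; apply: val_inj. Qed.
Fact endo_mulDr : right_distributive endo_mul +%R.
Proof. by move=> f g h; apply/val_inj/funext => x /=; rewrite endoD. Qed.

HB.instance Definition _ := GRing.Zmodule_isPzRing.Build endo
  endo_mulA endo_mul1r endo_mulr1 endo_mulDl endo_mulDr.

Lemma endo_sumE (I : Type) (s : seq I) (F : I -> endo) x :
  (\sum_(i <- s) F i) x = \sum_(i <- s) F i x.
Proof. by elim/big_rec2: _ => // i y z _ <-. Qed.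

Lemma endo_expE f n x : (f ^+ n) x = iter n f x.
Proof. by elim: n => // n IH; rewrite exprS /= IH. Qed.

Lemma endo_addE f g x : (f + g) x = f x + g x.
Proof. by []. Qed.

Lemma endo_eq f g : f =1 g -> f = g.
Proof. by move=> fg; apply/val_inj/funext. Qed.

End AdditiveEndomorphisms.

Arguments endo : clear implicits.

(** * Powers and nilpotency for commuting ring elements *)

Section CommutingElements.
Context {E : pzRingType}.

(** In each binomial term either [y] has exponent at least [n], and the term vanishes, or [x] has
    exponent at least [m], and [x ^+ m] splits off. *)
Lemma expr_perturb (x y : E) (m n : nat) :
  (0 < n)%N -> GRing.comm x y -> y ^+ n = 0 ->
  exists p, (x + y) ^+ (m + n - 1) = p * x ^+ m.
Proof.
move=> n_gt0 cxy yn0; rewrite exprDn_comm//.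
elim/big_ind: _ => [|a b [p ->] [q ->]|[i /= _] _].
- by exists 0; rewrite mul0r.
- by exists (p + q); rewrite mulrDl.
have [n_le_i|i_lt_n] := leqP n i.
  by exists 0; rewrite -(subnK n_le_i) exprD yn0 !mulr0 mul0rn mul0r.
(* Since [i < n], the subtraction [n - 1 - i] is not truncated; it counts the factors [x] beyond the
   [m] split off. *)
exists (y ^+ i * x ^+ (n - 1 - i) *+ 'C(m + n - 1, i)).
have -> : (m + n - 1 - i = n - 1 - i + m)%N by lia.
rewrite mulrnAl -mulrA -exprD; congr (_ *+ _).
exact/commrX/commr_sym/commrX/commr_sym.
Qed.

(** The case [m = n1] of [expr_perturb], where the power split off is itself zero. *)
Lemma expr_add_nilp (u v : E) (n1 n2 : nat) :
  (0 < n2)%N -> GRing.comm u v -> u ^+ n1 = 0 -> v ^+ n2 = 0 ->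
  (u + v) ^+ (n1 + n2 - 1) = 0.
Proof.
by move=> n2_gt0 cuv un0 vn0; have [p ->] := expr_perturb u v n1 n2 n2_gt0 cuv vn0;
  rewrite un0 mulr0.
Qed.

Lemma prodrM_comm (I : Type) (s : seq I) (F G : I -> E) :
  (forall i j, GRing.comm (F i) (G j)) ->
  \prod_(i <- s) (F i * G i) = (\prod_(i <- s) F i) * \prod_(i <- s) G i.
Proof.
move=> cFG; elim: s => [|i s IH]; first by rewrite !big_nil mul1r.
rewrite !big_cons IH -!mulrA; congr (_ * _); rewrite !mulrA; congr (_ * _).
by apply: commr_prod => j _; apply/commr_sym.
Qed.

Lemma sum_nilp (d n : nat) (N c : 'I_d -> E) :
  (forall s : seq 'I_d, size s = n -> \prod_(i <- s) N i = 0) ->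
  (forall i j, GRing.comm (c i) (N j)) ->
  (\sum_i N i * c i) ^+ n = 0.
Proof.
move=> N0 ccN.
(* Trading factors of the power for a word in [N] one at a time avoids the
   multinomial expansion. *)
suff H k (s : seq 'I_d) : (k + size s = n)%N ->
    (\sum_i N i * c i) ^+ k * \prod_(i <- s) N i = 0.
  by have := H n [::] (addn0 n); rewrite big_nil mulr1.
elim: k s => [|k IH] s; first by move=> /N0 ->; rewrite mulr0.
move=> ks; rewrite exprSr -mulrA mulr_suml mulr_sumr big1// => i _.
have ck : GRing.comm (c i) (\prod_(j <- s) N j) by apply: commr_prod.
have := IH (i :: s); rewrite big_cons /= addnS -addSn => /(_ ks) H.
by rewrite -mulrA ck !mulrA -(mulrA _ (N i)) H mul0r.
Qed.

End CommutingElements.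

(** Commutation sorts the word [s], each index getting its multiplicity as exponent. This links
    words, as used in [sum_nilp], to the multi-indices defining nilpotency. *)
Lemma prod_multi_pow (S : pzRingType) (d : nat) (N : 'I_d -> S) (s : seq 'I_d) :
  commuting N -> \prod_(i <- s) N i = multi_pow N (fun j => count_mem j s).
Proof.
move=> cN; rewrite /multi_pow.
elim: s => [|i s IH]; first by rewrite big_nil big1.
under [RHS]eq_bigr do rewrite exprD.
rewrite prodrM_comm => [|j k]; last exact/commrX/commr_sym/commrX/cN.
rewrite big_cons IH; congr (_ * _).
(* The new letter [N i] is the product over all [j] of [N j] raised to the truth value of
   [i == j]. *)
rewrite -[LHS](big_pred1_eq *%R i N) [LHS]big_mkcond /=.
by apply: eq_bigr => j _ /=; rewrite eq_sym; case: eqP.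
Qed.

(** The multiplicities in a word add up to its length, so the word is a monomial of degree [n]. *)
Lemma nilpotent_word (S : pzRingType) (d n : nat) (N : 'I_d -> S) (s : seq 'I_d) :
  commuting N -> nilpotent_tuple n N -> size s = n -> \prod_(i <- s) N i = 0.
Proof.
move=> cN [_ N0 _] sn; rewrite prod_multi_pow//; apply: N0.
rewrite -sn; elim: s {sn} => [|i s IH]; first by rewrite big1.
rewrite big_split /= IH -add1n; congr (_ + _)%N.
rewrite -(big_pred1_eq addn i (fun=> 1%N)) [RHS]big_mkcond /=.
by apply: eq_bigr => j _; rewrite eq_sym; case: eqP.
Qed.

(** * Left and right multiplications as endomorphisms *)

Section Multiplications.
Context {S : pzRingType}.

Fact lmul_additive (a : S) : (fun x => a * x) \in additive_map.
Proof. by apply/additive_mapP => x y; rewrite mulrBr. Qed.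

Fact rmul_additive (b : S) : (fun x => x * b) \in additive_map.
Proof. by apply/additive_mapP => x y; rewrite mulrBl. Qed.

Definition lmul a : endo S := Endo _ (lmul_additive a).
Definition rmul b : endo S := Endo _ (rmul_additive b).

Lemma comm_lmul_rmul a b : GRing.comm (lmul a) (rmul b).
Proof. by apply: endo_eq => x /=; rewrite mulrA. Qed.

Lemma comm_lmul a b : GRing.comm a b -> GRing.comm (lmul a) (lmul b).
Proof. by move=> cab; apply: endo_eq => x /=; rewrite !mulrA cab. Qed.

Lemma comm_rmul a b : GRing.comm a b -> GRing.comm (rmul a) (rmul b).
Proof. by move=> cab; apply: endo_eq => x /=; rewrite -!mulrA cab. Qed.

Lemma lmul_prod (I : Type) (s : seq I) (F : I -> S) :
  \prod_(i <- s) lmul (F i) = lmul (\prod_(i <- s) F i).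
Proof.
elim: s => [|i s IH]; first by rewrite !big_nil; apply: endo_eq => x /=; rewrite mul1r.
by rewrite !big_cons IH; apply: endo_eq => x /=; rewrite mulrA.
Qed.

(** Composing right multiplications reverses the order of the factors, hence [rev]. *)
Lemma rmul_prod (I : Type) (s : seq I) (F : I -> S) :
  \prod_(i <- s) rmul (F i) = rmul (\prod_(i <- rev s) F i).
Proof.
elim: s => [|i s IH]; first by rewrite !big_nil; apply: endo_eq => x /=; rewrite mulr1.
rewrite big_cons IH rev_cons -cats1 big_cat big_seq1.
by apply: endo_eq => x /=; rewrite mulrA.
Qed.

Context {d : nat}.
Implicit Types A B : 'I_d -> S.

Definition triangle_endo A B : endo S := 1 - \sum_i lmul (A i) * rmul (B i).
Definition delta_endo A B : endo S := \sum_i lmul (A i) - \sum_i rmul (B i).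

Lemma triangle_endoE A B : triangle_endo A B =1 Triangle A B.
Proof.
move=> x; change (x - (\sum_i lmul (A i) * rmul (B i)) x = Triangle A B x).
rewrite endo_sumE /Triangle; congr (_ - _).
by apply: eq_bigr => i _ /=; rewrite mulrA.
Qed.

Lemma delta_endoE A B : delta_endo A B =1 delta A B.
Proof.
move=> x; change ((\sum_i lmul (A i)) x - (\sum_i rmul (B i)) x = delta A B x).
by rewrite !endo_sumE /delta mulr_suml mulr_sumr.
Qed.

Lemma iter_Triangle n A B x : iter n (Triangle A B) x = (triangle_endo A B ^+ n) x.
Proof. by rewrite endo_expE; apply: eq_iter => y; rewrite triangle_endoE. Qed.

Lemma iter_delta n A B x : iter n (delta A B) x = (delta_endo A B ^+ n) x.
Proof. by rewrite endo_expE; apply: eq_iter => y; rewrite delta_endoE. Qed.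

Lemma comm_triangle_endo (f : endo S) A B :
  (forall i, GRing.comm f (lmul (A i))) -> (forall i, GRing.comm f (rmul (B i))) ->
  GRing.comm f (triangle_endo A B).
Proof.
move=> fA fB; apply: commrB; first exact: commr1.
by apply: commr_sum => i _; apply: commrM.
Qed.

Lemma comm_delta_endo (f : endo S) A B :
  (forall i, GRing.comm f (lmul (A i))) -> (forall i, GRing.comm f (rmul (B i))) ->
  GRing.comm f (delta_endo A B).
Proof. by move=> fA fB; apply: commrB; apply: commr_sum. Qed.

End Multiplications.

(** * Perturbation of both operators by nilpotent tuples *)

Section Perturbation.
Context {S : pzRingType} {d : nat} {A B N1 N2 : 'I_d -> S} {n1 n2 : nat}.
Hypotheses (A_comm : commuting A) (B_comm : commuting B).
Hypotheses (N1_comm : commuting N1) (N2_comm : commuting N2).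
Hypotheses (N1_nil : nilpotent_tuple n1 N1) (N2_nil : nilpotent_tuple n2 N2).
Hypotheses (A_N1 : cross_commuting A N1) (B_N2 : cross_commuting B N2).

(** Common to both operators, whose perturbations have this shape and differ only in [f] and the
    coefficients [c1], [c2]. *)
Lemma perturb_pow (f : endo S) (c1 c2 : 'I_d -> endo S) (m : nat) :
  (forall i, GRing.comm f (lmul (N1 i))) -> (forall i, GRing.comm f (rmul (N2 i))) ->
  (forall i, GRing.comm f (c1 i)) -> (forall i, GRing.comm f (c2 i)) ->
  (forall i j, GRing.comm (c1 i) (lmul (N1 j))) ->
  (forall i j, GRing.comm (c1 i) (rmul (N2 j))) ->
  (forall i j, GRing.comm (c2 i) (lmul (N1 j))) ->
  (forall i j, GRing.comm (c2 i) (rmul (N2 j))) ->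
  (forall i j, GRing.comm (c1 i) (c2 j)) ->
  exists p, (f + (\sum_i lmul (N1 i) * c1 i + \sum_i rmul (N2 i) * c2 i))
              ^+ (m + n1 + n2 - 2) = p * f ^+ m.
Proof.
move=> fN1 fN2 fc1 fc2 c1N1 c1N2 c2N1 c2N2 c1c2.
have [[n1_gt0 _ _] [n2_gt0 _ _]] := (N1_nil, N2_nil).
(* The perturbation has nilpotency exponent [n1 + n2 - 1]; positivity of [n1] and [n2] keeps the
   subtractions exact. *)
have -> : (m + n1 + n2 - 2 = m + (n1 + n2 - 1) - 1)%N by lia.
apply: expr_perturb; first lia.
  by apply: commrD; apply: commr_sum => i _; apply: commrM.
apply: expr_add_nilp => //.
- apply: commr_sum => j _; apply/commr_sym/commr_sum => i _; apply: commrM.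
    by apply: commr_sym; apply: commrM; [exact: comm_lmul_rmul|apply/commr_sym].
  by apply: commr_sym; apply: commrM.
- apply: sum_nilp => // s sn1.
  by rewrite lmul_prod (nilpotent_word _ _ n1)//; apply: endo_eq => x /=; rewrite mul0r.
- apply: sum_nilp => // s sn2.
  rewrite rmul_prod (nilpotent_word _ _ n2) ?size_rev//.
  by apply: endo_eq => x /=; rewrite mulr0.
Qed.

(** Reduces commutation to multiplications by single entries: opposite sides commute by
    associativity, equal sides by the hypotheses on the tuples. *)
Ltac comm_mult :=
  lazymatch goal with
  | |- GRing.comm _ 1 => exact: commr1
  | |- GRing.comm 1 _ => exact/commr_sym/commr1
  | |- GRing.comm _ (- _) => apply: commrN; comm_mult
  | |- GRing.comm _ (_ + _) => apply: commrD; comm_mult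
  | |- GRing.comm (- _) _ => apply/commr_sym/commrN; comm_mult
  | |- GRing.comm (_ + _) _ => apply/commr_sym/commrD; comm_mult
  | |- GRing.comm (triangle_endo _ _) _ =>
      apply/commr_sym/comm_triangle_endo => ?; comm_mult
  | |- GRing.comm (delta_endo _ _) _ =>
      apply/commr_sym/comm_delta_endo => ?; comm_mult
  | |- GRing.comm (lmul _) (rmul _) => exact: comm_lmul_rmul
  | |- GRing.comm (rmul _) (lmul _) => exact/commr_sym/comm_lmul_rmul
  | |- GRing.comm (lmul _) (lmul _) => apply: comm_lmul; comm_mult
  | |- GRing.comm (rmul _) (rmul _) => apply: comm_rmul; comm_mult
  | |- _ => first [exact: A_comm | exact: B_comm | exact: N1_comm | exact: N2_comm
                  | exact: A_N1 | exact: B_N2 | exact/esym/A_N1 | exact/esym/B_N2]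
  end.

Lemma triangle_perturb (m : nat) :
  exists p, triangle_endo (tuple_add A N1) (tuple_add B N2) ^+ (m + n1 + n2 - 2) =
            p * triangle_endo A B ^+ m.
Proof.
(* Termwise, [(A + N1) x (B + N2) - A x B = N1 x B + (A + N1) x N2]: the mixed term [N1 x N2] is put
   into the [N2] part. *)
have -> : triangle_endo (tuple_add A N1) (tuple_add B N2) = triangle_endo A B +
    (\sum_i lmul (N1 i) * - rmul (B i) +
     \sum_i rmul (N2 i) * - (lmul (A i) + lmul (N1 i))).
  rewrite /triangle_endo -addrA -sumrN -sumrN -!big_split.
  congr (_ + _); apply: eq_bigr => i _.
  rewrite /= !mulrN -!opprD; congr (- _); apply: endo_eq => x.
  change ((A i + N1 i) * (x * (B i + N2 i)) =
    A i * (x * B i) + (N1 i * (x * B i) + (A i * x + N1 i * x) * N2 i)).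
  by rewrite mulrDr mulrDr -mulrDl -!mulrA !mulrDl -!addrA.
by apply: perturb_pow => *; comm_mult.
Qed.

Lemma delta_perturb (m : nat) :
  exists p, delta_endo (tuple_add A N1) (tuple_add B N2) ^+ (m + n1 + n2 - 2) =
            p * delta_endo A B ^+ m.
Proof.
(* The factors [1] and [-1] give the difference the shape required by [perturb_pow]. *)
have -> : delta_endo (tuple_add A N1) (tuple_add B N2) = delta_endo A B +
    (\sum_i lmul (N1 i) * 1 + \sum_i rmul (N2 i) * -1).
  rewrite /delta_endo -!mulr_suml mulr1 mulrN1 addrACA -big_split -opprD -big_split.
  congr (_ - _); apply: eq_bigr => i _; apply: endo_eq => x.
    by rewrite endo_addE /= mulrDl.
  by rewrite endo_addE /= mulrDr.
by apply: perturb_pow => *; comm_mult.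
Qed.

(** The cofactor [q] comes with no commutation property. So the [m1]-th power of the original
    triangle map first passes the whole power of [D']; only then is [D'] factored, and the two
    original powers meet at [X]. *)
Lemma triangle_delta_perturb (m1 m2 : nat) (X : S) :
  iter m1 (Triangle A B) (iter m2 (delta A B) X) = 0 ->
  iter (m1 + n1 + n2 - 2) (Triangle (tuple_add A N1) (tuple_add B N2))
    (iter (m2 + n1 + n2 - 2) (delta (tuple_add A N1) (tuple_add B N2)) X) = 0.
Proof.
rewrite !iter_Triangle !iter_delta => hX.
have [p ->] := triangle_perturb m1; have [q qE] := delta_perturb m2.
set D' := delta_endo _ _ in qE *.
have cTD : GRing.comm (triangle_endo A B) (delta_endo A B).
  by apply: comm_delta_endo => i; comm_mult.
have cTD' : GRing.comm (triangle_endo A B) D'.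
  by apply: comm_delta_endo => i; rewrite /tuple_add; comm_mult.
have cX f g k l : GRing.comm f g -> GRing.comm (f ^+ k : endo S) (g ^+ l).
  by move=> cfg; apply/commrX/commr_sym/commrX/commr_sym.
change (p ((triangle_endo A B ^+ m1 * D' ^+ (m2 + n1 + n2 - 2)) X) = 0).
rewrite (cX _ _ _ _ cTD') qE -mulrA -(cX _ _ _ _ cTD).
change (p (q ((triangle_endo A B ^+ m1) ((delta_endo A B ^+ m2) X))) = 0).
by rewrite hX !endo0.
Qed.

End Perturbation.

Theorem theorem3p1 (R : realType) (V : completeNormedModType R[i])
    (V_infinite : ~ finite_dimensional V)
    (d : nat) (d_ge1 : (1 <= d)%N)
    (X : 'B(V)) (A B : 'I_d -> 'B(V))
    (A_comm : commuting A) (B_comm : commuting B)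
    (m1 m2 : nat) (m1_gt0 : (0 < m1)%N) (m2_gt0 : (0 < m2)%N)
    (hX : iter m1 (Triangle A B) (iter m2 (delta A B) X) = 0)
    (n1 n2 : nat) (N1 N2 : 'I_d -> 'B(V))
    (N1_comm : commuting N1) (N2_comm : commuting N2)
    (N1_nil : nilpotent_tuple n1 N1) (N2_nil : nilpotent_tuple n2 N2)
    (A_N1 : cross_commuting A N1) (B_N2 : cross_commuting B N2) :
  iter (m1 + n1 + n2 - 2) (Triangle (tuple_add A N1) (tuple_add B N2))
    (iter (m2 + n1 + n2 - 2) (delta (tuple_add A N1) (tuple_add B N2)) X) = 0.
Proof.
exact: (triangle_delta_perturb (n1 := n1) (n2 := n2)).
Qed.
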